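(* For all sufficiently large real $x$, we have $$\#\mathcal{N}_{10}(x) < x^{0.717}$$ and $$x^{0.526} < \#\mathcal{N}_{10,0}(x) < x^{0.787}.$$
   Context: For a positive integer $n$, let $p_{10}(n)$ be the product of all the base $10$ digits of $n$ (in its usual representation without leading zeros), and let $p_{10,0}(n)$ be the product of the nonzero base $10$ digits of $n$. For real $x \geq 1$, define the sets of positive integers $$\mathcal{N}_{10}(x) := \{n \leq x : p_{10}(n) \mid n\}, \qquad \mathcal{N}_{10,0}(x) := \{n \leq x : p_{10,0}(n) \mid n\}.$$ (If $n$ has a zero digit then $p_{10}(n)=0$ does not divide $n$.) $\#S$ denotes the cardinality of the set $S$. *)

(* Defs.v *)
From mathcomp Require Import all_boot all_order all_algebra.
From mathcomp Require Import finmap.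
From mathcomp Require Import all_classical all_reals all_analysis.

Set Implicit Arguments.
Unset Strict Implicit.
Unset Printing Implicit Defensive.

Import Order.TTheory GRing.Theory Num.Theory.

Local Open Scope classical_set_scope.
Local Open Scope ring_scope.

(* Least significant digit first. For n > 0 and b > 1, [trunc_log b n] is the
   position of the leading digit, so there are no leading zeros. *)
Definition digits (b n : nat) : seq nat :=
  [seq ((n %/ b ^ i) %% b)%N | i <- iota 0 (trunc_log b n).+1].

Definition p10 (n : nat) : nat := (\prod_(d <- digits 10 n) d)%N.

Definition p10_0 (n : nat) : nat := (\prod_(d <- digits 10 n | d != 0) d)%N.

Definition N10 (R : realType) (x : R) : set nat :=
  [set n | (0 < n)%N /\ n%:R <= x /\ (p10 n %| n)%N].

Definition N10_0 (R : realType) (x : R) : set nat :=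
  [set n | (0 < n)%N /\ n%:R <= x /\ (p10_0 n %| n)%N].

(* [fset_set] is the empty set on infinite sets; the two lemmas below show that
   this case does not arise for [N10 x] and [N10_0 x]. *)
Definition ncard (A : set nat) : nat := #|` fset_set A|.

Lemma finite_nat_le (R : realType) (x : R) : finite_set [set n : nat | n%:R <= x].
Proof.
apply: (@sub_finite_set _ _ `I_(Num.truncn x).+1); last exact: finite_II.
by move=> n /= nx; rewrite ltnS truncn_ge_nat // (le_trans _ nx).
Qed.

Lemma finite_N10 (R : realType) (x : R) : finite_set (N10 x).
Proof. by apply: sub_finite_set (finite_nat_le x) => n [_ []]. Qed.

Lemma finite_N10_0 (R : realType) (x : R) : finite_set (N10_0 x).
Proof. by apply: sub_finite_set (finite_nat_le x) => n [_ []]. Qed.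

(* Main.v *)
(** Upper bounds: if [Q] is the digit product of [n] and [Q %| n], then the
    number [c] of such [n] of length [L] satisfies both [c <= 10^L / Q] and,
    by Rankin's trick, [c <= Q^s W^L] with [W] the sum of [d^(-s)] over the
    digits 1..9, plus 1 when zero digits are allowed. Eliminating [Q] gives
    [c^(1+s) <= (10^s W)^L], and [Q], being 7-smooth, takes only polynomially
    many values; [s = 13/10] and [s = 7/5] give the two exponents.

    Lower bound: draw the digits of [m] independently from a distribution on
    {0,1,2,4,5,8}. For typical [m] of length [L] the digit product is
    [2^a 5^b] with [a, b <= t := tau L], so it divides [m 10^t], which has the
    same nonzero digits; by the weak law of large numbers there are about
    [exp(entropy * L)] typical [m]. *)
Require Import Defs.
From mathcomp Require Import all_boot all_order all_algebra.
From mathcomp Require Import finmap.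
From mathcomp Require Import all_classical all_reals all_analysis.
From mathcomp Require Import ring lra zify.
Import Order.TTheory GRing.Theory Num.Theory.
Local Open Scope ring_scope.

(** * Decimal digits and sums over digit words *)

Definition digit (i n : nat) : nat := ((n %/ 10 ^ i) %% 10)%N.

Lemma digit_lt10 i n : (digit i n < 10)%N.
Proof. by rewrite ltn_mod. Qed.

Lemma digit0_cons q d : (d < 10)%N -> digit 0 (q * 10 + d)%N = d.
Proof. by move=> d10; rewrite /digit divn1 modnMDl modn_small. Qed.

Lemma digitS_cons i q d : (d < 10)%N -> digit i.+1 (q * 10 + d)%N = digit i q.
Proof.
by move=> d10; rewrite /digit expnS divnMA divnMDl // (divn_small d10) addn0.
Qed.

Lemma digit_small i n : (n < 10 ^ i)%N -> digit i n = 0%N.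
Proof. by move=> ni; rewrite /digit divn_small. Qed.

Lemma digit_ltM10 i t m : (i < t)%N -> digit i (m * 10 ^ t)%N = 0%N.
Proof.
move=> it; rewrite /digit -(subnK (ltnW it)) expnD mulnA mulnK ?expn_gt0 //.
by rewrite -(prednK (n := t - i)) ?subn_gt0 // expnS mulnCA modnMr.
Qed.

Lemma digit_addM10 i t m : digit (t + i) (m * 10 ^ t)%N = digit i m.
Proof. by rewrite /digit expnD divnMA mulnK ?expn_gt0. Qed.

Lemma sum_words (V : nmodType) L (F : nat -> V) :
  \sum_(0 <= n < 10 ^ L.+1) F n =
  \sum_(0 <= q < 10 ^ L) \sum_(d < 10) F (q * 10 + d)%N.
Proof.
rewrite expnSr; elim: (10 ^ L)%N => [|m IH]; first by rewrite mul0n !big_geq.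
rewrite [RHS]big_nat_recr //= -IH mulSnr.
rewrite (@big_cat_nat _ _ _ (m * 10)) ?leq_addr //=.
congr (_ + _); rewrite -{1}(add0n (m * 10)%N) big_addn addKn big_mkord.
by apply: eq_bigr => i _; rewrite addnC.
Qed.

Lemma prod_digits_cons (S : comPzSemiRingType) (w : nat -> S) L q (d : 'I_10) :
  \prod_(i < L.+1) w (digit i (q * 10 + d)) =
  w d * \prod_(i < L) w (digit i q).
Proof.
rewrite big_ord_recl digit0_cons //; congr (_ * _).
by apply: eq_bigr => i _; rewrite digitS_cons.
Qed.

Lemma sum_digits_cons (V : nmodType) (f : nat -> V) L q (d : 'I_10) :
  \sum_(i < L.+1) f (digit i (q * 10 + d)) = f d + \sum_(i < L) f (digit i q).
Proof.
rewrite big_ord_recl digit0_cons //; congr (_ + _).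
by apply: eq_bigr => i _; rewrite digitS_cons.
Qed.

(** The numbers below [10 ^ L], padded with leading zeros, are exactly the words of [L] digits, so
    the sum of a multiplicative weight factors digit by digit. *)
Lemma sum_prod_digits (S : comPzSemiRingType) (w : nat -> S) L :
  \sum_(0 <= n < 10 ^ L) \prod_(i < L) w (digit i n) = (\sum_(d < 10) w d) ^+ L.
Proof.
elim: L => [|L IH]; first by rewrite big_nat1 big_ord0 expr0.
rewrite sum_words exprS -IH mulr_sumr; apply: eq_bigr => q _.
by rewrite mulr_suml; apply: eq_bigr => d _; rewrite prod_digits_cons.
Qed.

(** * The product of nonzero digits and its prime factors *)

Definition nzdigit (d : nat) : nat := if d == 0%N then 1%N else d.

(** Padding zeros contribute the factor 1 through [nzdigit], so every [L] that bounds the length of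
    [n] gives the same product. *)
Lemma p10_0E L n : (0 < n)%N -> (n < 10 ^ L)%N ->
  p10_0 n = (\prod_(i < L) nzdigit (digit i n))%N.
Proof.
move=> n0 nL; rewrite /p10_0 /digits big_map big_mkcond /=.
have TL : ((trunc_log 10 n).+1 <= L)%N.
  by rewrite -(@ltn_exp2l 10) // (leq_ltn_trans _ nL) // trunc_logP.
transitivity (\prod_(0 <= i < (trunc_log 10 n).+1) nzdigit (digit i n))%N.
  rewrite /index_iota subn0; apply: eq_bigr => i _.
  by rewrite /nzdigit /digit; case: eqP.
rewrite -(big_mkord xpredT (fun i => nzdigit (digit i n))).
rewrite (@big_cat_nat _ _ _ _ 0 L _ _ _ TL) //=.
rewrite [X in (_ * X)%N]big1_seq ?muln1 //.
move=> i; rewrite mem_index_iota => /andP[_ /andP[Ti _]].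
rewrite digit_small // (leq_trans (trunc_log_ltn n (isT : (1 < 10)%N))) //.
by rewrite leq_exp2l.
Qed.

Lemma p10_0_shift m t : (0 < m)%N -> p10_0 (m * 10 ^ t) = p10_0 m.
Proof.
move=> m0; have mL := trunc_log_ltn m (isT : (1 < 10)%N).
rewrite (p10_0E _ _ m0 mL) (p10_0E (t + (trunc_log 10 m).+1)).
- rewrite big_split_ord /= [X in (X * _)%N]big1 ?mul1n => [|i _].
    by apply: eq_bigr => i _; rewrite digit_addM10.
  by rewrite digit_ltM10.
- by rewrite muln_gt0 m0 expn_gt0.
- by rewrite expnD mulnC ltn_pmul2l ?expn_gt0.
Qed.

Lemma p10_digit_neq0 n i : (0 < n)%N -> (p10 n %| n)%N ->
  (i < (trunc_log 10 n).+1)%N -> digit i n != 0%N.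
Proof.
move=> n0 dvd iT; rewrite -lt0n; apply: (dvdn_gt0 n0); apply: dvdn_trans dvd.
have iP : i \in iota 0 (trunc_log 10 n).+1 by rewrite mem_iota.
by rewrite /p10 /digits big_map (big_rem i iP) dvdn_mulr.
Qed.

(** A zero digit would make [p10 n] vanish, and 0 does not divide a positive [n]. This lets the
    upper bound for [N10] run on [p10_0]. *)
Lemma p10_eq_p10_0 n : (0 < n)%N -> (p10 n %| n)%N -> p10 n = p10_0 n.
Proof.
move=> n0 dvd; rewrite /p10_0 /p10 /digits !big_map [RHS]big_mkcond.
apply: eq_big_seq => i; rewrite mem_iota add0n => /= iT.
by have := p10_digit_neq0 n i n0 dvd iT; rewrite /digit => ->.
Qed.

(** Since [logn p 0 = 0], the zero digit fits the formula with all exponents 0; the bound 3 comes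
    from [8 = 2 ^ 3]. *)
Lemma nzdigit_factors d : (d < 10)%N ->
  nzdigit d = (2 ^ logn 2 d * 3 ^ logn 3 d * 5 ^ logn 5 d * 7 ^ logn 7 d)%N /\
  [/\ logn 2 d <= 3, logn 3 d <= 3, logn 5 d <= 3 & logn 7 d <= 3]%N.
Proof. by do 10 (case: d => [|d] //). Qed.

Definition digit_val (p L n : nat) : nat := (\sum_(i < L) logn p (digit i n))%N.

Lemma p10_0_factors L n : (0 < n)%N -> (n < 10 ^ L)%N ->
  p10_0 n = (2 ^ digit_val 2 L n * 3 ^ digit_val 3 L n *
             5 ^ digit_val 5 L n * 7 ^ digit_val 7 L n)%N.
Proof.
move=> n0 nL; rewrite (p10_0E _ _ n0 nL) /digit_val !expn_sum -!big_split /=.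
by apply: eq_bigr => i _; case: (nzdigit_factors _ (digit_lt10 i n)).
Qed.

Lemma digit_val_le p L n : p \in [:: 2; 3; 5; 7]%N ->
  (digit_val p L n <= 3 * L)%N.
Proof.
move=> pP; rewrite mulnC -[X in (X * 3)%N]card_ord -sum_nat_const.
apply: leq_sum => i _.
have [_ []] := nzdigit_factors _ (digit_lt10 i n).
by move: pP; rewrite !inE => /or4P[] /eqP->.
Qed.

(** * Rankin's bound for the number of solutions *)

Lemma count_multiples N Q : (0 < Q)%N ->
  ((\sum_(0 <= n < N | (0 < n) && (Q %| n)) 1) * Q <= N)%N.
Proof.
move=> Q0; case: N => [|N]; first by rewrite big_geq.
apply: leq_trans (leqnSn N); rewrite -leq_divRL //.
elim: N => [|N IH]; first by rewrite big_mkcond big_nat1.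
rewrite big_mkcond big_nat_recr //= -big_mkcond /= divnS // addnC.
by rewrite leq_add //; case: (_ %| _)%N.
Qed.

Lemma powR_prod (R : realType) (I : Type) (r : seq I) (F : I -> R) s :
  (forall i, 0 <= F i) ->
  (\prod_(i <- r) F i) `^ s = \prod_(i <- r) F i `^ s.
Proof.
move=> F0; elim: r => [|i r IH]; first by rewrite !big_nil powR1.
by rewrite !big_cons powRM ?prodr_ge0 // IH.
Qed.

(** A large [Q] leaves few multiples, a small [Q] leaves few words of weight [Q^(-s)]; the product
    of the first bound to the power [s] with the second no longer involves [Q]. *)
Lemma rankin_class (R : realType) (w : nat -> R) (s : R) L Q (A : pred nat) :
  0 < s -> (forall d, 0 <= w d) -> (0 < Q)%N ->
  (forall n, (n < 10 ^ L)%N -> A n -> [/\ (0 < n)%N, (Q %| n)%N &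
    \prod_(i < L) w (digit i n) = Q%:R `^ (- s)]) ->
  (\sum_(0 <= n < 10 ^ L | A n) 1)%N%:R `^ (1 + s) <=
  (10 `^ s * \sum_(d < 10) w d) ^+ L.
Proof.
move=> s0 w0 Q0 AP; set c := (\sum_(_ <= n < _ | _) 1)%N.
have cQ : (c * Q <= 10 ^ L)%N.
  apply: leq_trans (count_multiples (10 ^ L) Q Q0); rewrite leq_mul2r.
  apply/orP; right; rewrite /c big_mkcond [leqRHS]big_mkcond /=.
  rewrite big_nat [leqRHS]big_nat; apply: leq_sum => n /andP[_ nL].
  by case: ifP => // An; have [-> ->] := AP n nL An.
(* Each member of the class contributes [Q^(-s)] to the full weighted sum, whose other terms are
   nonnegative. *)
have cW : c%:R * Q%:R `^ (- s) <= (\sum_(d < 10) w d) ^+ L.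
  rewrite -sum_prod_digits /c natr_sum mulr_suml big_mkcond /=.
  rewrite big_nat [leRHS]big_nat; apply: ler_sum => n /andP[_ nL].
  case: ifP => An; last exact: prodr_ge0.
  by have [_ _ ->] := AP n nL An; rewrite mul1r.
have Qs0 : 0 < Q%:R `^ s :> R by rewrite powR_gt0 // ltr0n.
rewrite powRD ?powRr1 ?ler0n //; last by rewrite gt_eqF // ltr_wpDl.
rewrite exprMn [leRHS]mulrC.
have -> : c%:R * c%:R `^ s = (c%:R * Q%:R `^ (- s)) * (c * Q)%:R `^ s :> R.
  rewrite natrM powRM ?ler0n // powRN [_ `^ s * Q%:R `^ s]mulrC mulrA.
  by rewrite divfK // gt_eqF.
apply: ler_pM; rewrite ?mulr_ge0 ?powR_ge0 ?ler0n //.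
rewrite -powR_mulrn ?powR_ge0 // powRAC powR_mulrn ?ler0n // -natrX.
by apply: ge0_ler_powR; rewrite ?nnegrE ?ler_nat ?ler0n // ltW.
Qed.

(** Numbers are sorted by length and by the exponents of 2, 3, 5, 7 in [p10_0 n]: at most
    [(4 * K.+1) ^ 5] classes, each controlled by [rankin_class]. Lengths are kept apart because the
    weight runs over the true digits only; padding would bring in factors [w 0]. *)
Lemma rankin_count (R : realType) (w : nat -> R) (s delta : R) (A : pred nat)
    K :
  0 < s -> 0 <= delta -> (forall d, 0 <= w d) ->
  \sum_(d < 10) w d <= 10 `^ delta ->
  (forall n, A n -> [/\ (0 < n)%N, (p10_0 n %| n)%N &
    \prod_(i < (trunc_log 10 n).+1) w (digit i n) = (p10_0 n)%:R `^ (- s)]) ->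
  (\sum_(0 <= n < 10 ^ K.+1 | A n) 1)%N%:R <=
  (4 * K.+1)%:R ^+ 5 * (10 `^ ((s + delta) / (1 + s))) ^+ K.+1.
Proof.
move=> s0 d0 w0 W AP; set theta := 10 `^ _; set M := (4 * K.+1)%N.
have s1 : 0 < 1 + s by rewrite ltr_wpDl.
have theta1 : 1 <= theta.
  rewrite -[leLHS](powRr0 10) ler_powR ?ler1n // divr_ge0 // ltW //.
  by rewrite ltr_wpDr.
pose Q (v : 'I_M * 'I_M * 'I_M * 'I_M) : nat :=
  (2 ^ v.1.1.1 * 3 ^ v.1.1.2 * 5 ^ v.1.2 * 7 ^ v.2)%N.
pose B (v : 'I_K.+2 * ('I_M * 'I_M * 'I_M * 'I_M)) (n : nat) :=
  [&& A n, (trunc_log 10 n).+1 == v.1 & p10_0 n == Q v.2].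
have cB v : (\sum_(0 <= n < 10 ^ K.+1 | B v n) 1)%N%:R <= theta ^+ K.+1.
  have vK : (v.1 <= K.+1)%N by rewrite -ltnS.
  (* A number of length [v.1] lies below [10 ^ v.1], so the range can be cut there. *)
  have -> : (\sum_(0 <= n < 10 ^ K.+1 | B v n) 1)%N =
            (\sum_(0 <= n < 10 ^ v.1 | B v n) 1)%N.
    rewrite (@big_cat_nat _ _ _ (10 ^ v.1)) ?leq_exp2l //=.
    rewrite [X in (_ + X)%N]big_nat_cond [X in (_ + X)%N]big1 ?addn0 // => n.
    move=> /andP[/andP[vn _] /and3P[_ /eqP vE _]].
    by move: vn; rewrite -vE leqNgt trunc_log_ltn.
  apply: le_trans (ler_weXn2l theta1 vK).
  have := @rankin_class R w s v.1 (Q v.2) (B v) s0 w0.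
  set c := (\sum_(_ <= n < _ | _) 1)%N => cP.
  have {}cP : c%:R `^ (1 + s) <= (10 `^ s * \sum_(d < 10) w d) ^+ v.1.
    apply: cP => [|n nv]; first by rewrite !muln_gt0 !expn_gt0.
    by case/and3P => /AP[n0 dvd wE] /eqP vE /eqP QE; rewrite -vE -QE.
  have {}cP : c%:R `^ (1 + s) <= (theta ^+ v.1) `^ (1 + s).
    apply: le_trans cP _.
    rewrite -[theta ^+ _]powR_mulrn ?powR_ge0 // powRAC powR_mulrn ?powR_ge0 //.
    apply: lerXn2r; rewrite ?nnegrE ?powR_ge0 ?mulr_ge0 ?sumr_ge0 ?powR_ge0 //.
    rewrite /theta -powRrM divfK ?gt_eqF // powRD ?pnatr_eq0 ?implybT //.
    by rewrite ler_pM2l // powR_gt0.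
  rewrite leNgt; apply/negP => lt; move: cP; apply/negP; rewrite -ltNge.
  by apply: gt0_ltr_powR; rewrite ?nnegrE ?exprn_ge0 ?powR_ge0.
have cover : (\sum_(0 <= n < 10 ^ K.+1 | A n) 1 <=
    \sum_v \sum_(0 <= n < 10 ^ K.+1 | B v n) 1)%N.
  under [leqRHS]eq_bigr do rewrite big_mkcond.
  rewrite exchange_big big_mkcond big_nat [leqRHS]big_nat /=.
  apply: leq_sum => n nK; case: ifP => // An.
  have [n0 _ _] := AP n An.
  have TK : (trunc_log 10 n < K.+1)%N.
    by rewrite -(@ltn_exp2l 10) // (leq_ltn_trans _ nK) // trunc_logP.
  have lt p : p \in [:: 2; 3; 5; 7]%N -> (digit_val p K.+1 n < M)%N.
    by move=> pP; have := digit_val_le p K.+1 n pP; rewrite /M; lia.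
  pose v : 'I_K.+2 * ('I_M * 'I_M * 'I_M * 'I_M) :=
    (Ordinal (TK : _.+1 < K.+2)%N, (Ordinal (lt 2 isT), Ordinal (lt 3 isT),
     Ordinal (lt 5 isT), Ordinal (lt 7 isT))).
  rewrite (bigD1 v) //= /B An eqxx /Q /=.
  by rewrite -(p10_0_factors _ _ n0 nK) eqxx.
apply: le_trans (_ :
  \sum_(v : 'I_K.+2 * ('I_M * 'I_M * 'I_M * 'I_M)) theta ^+ K.+1 <= _).
  move: cover; rewrite -(ler_nat R) => /le_trans; apply.
  by rewrite natr_sum; apply: ler_sum => v _; exact: cB.
rewrite sumr_const !card_prod !card_ord -[leLHS]mulr_natl.
rewrite ler_wpM2r ?exprn_ge0 ?powR_ge0 // -natrX ler_nat.
rewrite [leqRHS]expnS leq_mul //; first by rewrite /M; lia.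
by rewrite !expnS expn0 muln1 !mulnA.
Qed.

(** * From powers of ten to real [x] *)

(** With [rho] the root of [r] of order [j.+1], Bernoulli's inequality makes [rho ^ K] at least
    linear in [K]. Its power [j.+1] has one factor [K.+1] to spare, which beats the constant [C]. *)
Lemma poly_lt_exp (R : realType) (C r : R) j : 1 < r ->
  exists K0, forall K, (K0 <= K)%N -> C * K.+1%:R ^+ j < r ^+ K.
Proof.
move=> r1; pose rho := r `^ (j.+1%:R^-1).
have rhoE : rho ^+ j.+1 = r.
  rewrite -powR_mulrn ?powR_ge0 // -powRrM mulVf ?pnatr_eq0 // powRr1 //.
  by rewrite ltW // (lt_trans ltr01).
have rho1 : 1 < rho.
  rewrite -(@ltr_pXn2r _ j.+1) ?nnegrE ?powR_ge0 //.
  by rewrite expr1n rhoE.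
(* The cap at 1 gives [eta * K.+1 <= 1 + K * eta], and [1 + eta <= rho] feeds Bernoulli's
   inequality. *)
pose eta := Num.min 1 (rho - 1).
have eta0 : 0 < eta by rewrite lt_min ltr01 subr_gt0.
have etaX K : eta * K.+1%:R <= rho ^+ K.
  apply: (@le_trans _ _ (1 + K%:R * eta)).
    by rewrite -natr1 mulrDr mulr1 mulrC addrC lerD2r ge_min lexx.
  elim: K => [|K IH]; first by rewrite mul0r addr0 expr0.
  have eta_rho : 1 + eta <= rho by rewrite -lerBrDl ge_min lexx orbT.
  apply: (@le_trans _ _ ((1 + eta) * (1 + K%:R * eta))).
    have : 0 <= K%:R * eta * eta by rewrite !mulr_ge0 // ltW.
    by rewrite -natr1; lra.
  by rewrite exprS ler_pM // addr_ge0 // ?mulr_ge0 // ltW.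
exists (Num.truncn (`|C| / eta ^+ j.+1)) => K K0.
rewrite -rhoE -exprM mulnC exprM.
apply: lt_le_trans (_ : (eta * K.+1%:R) ^+ j.+1 <= _); last first.
  apply: lerXn2r => //; rewrite nnegrE ?exprn_ge0 ?powR_ge0 //.
  by rewrite mulr_ge0 // ltW.
rewrite exprMn [K.+1%:R ^+ j.+1]exprS mulrA ltr_pM2r ?exprn_gt0 ?ltr0n //.
apply: le_lt_trans (ler_norm _) _.
rewrite mulrC -ltr_pdivrMr ?exprn_gt0 //.
apply: lt_le_trans (truncnS_gt _) _.
by rewrite ler_nat ltnS.
Qed.

Lemma exists_pow10 (R : realType) (x : R) K0 : 10 ^+ K0 <= x ->
  exists K, [/\ (K0 <= K)%N, 10 ^+ K <= x & x < 10 ^+ K.+1].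
Proof.
move=> K0x; have x0 : 0 <= x by apply: le_trans K0x; exact: exprn_ge0.
have x1 : 1 <= x by apply: le_trans K0x; exact: exprn_ege1 (ler1n _ 10).
have t0 : (0 < Num.truncn x)%N by rewrite truncn_gt_nat.
exists (trunc_log 10 (Num.truncn x)); split.
- by apply: trunc_log_max => //; rewrite truncn_ge_nat // natrX.
- by rewrite -natrX -truncn_ge_nat // trunc_logP.
- by rewrite -natrX -truncn_lt_nat // trunc_log_ltn.
Qed.

Lemma ncard_sum (A : set nat) N : (forall n, A n -> (n < N)%N) ->
  ncard A = (\sum_(0 <= n < N | n \in A) 1)%N.
Proof.
move=> AN; have finA : finite_set A.
  by apply: sub_finite_set (finite_II N) => n /AN.
rewrite sum1_count -size_filter /ncard; apply: perm_size.
apply: uniq_perm; first exact: fset_uniq.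
  by rewrite filter_uniq // iota_uniq.
move=> n; rewrite mem_filter mem_index_iota /=.
have := in_fset_set finA; move=> /(_ n) ->.
by case: (boolP (n \in A)) => //= /set_mem /AN ->.
Qed.

(** The count has exponent [tau = (s + delta) / (1 + s)] up to a polynomial factor, which the gap
    between [tau] and [sigma] absorbs. *)
Lemma ncard_upper (R : realType) (w : nat -> R) (s delta sigma : R)
    (A : R -> set nat) :
  0 < s -> 0 <= delta -> (forall d, 0 <= w d) ->
  \sum_(d < 10) w d <= 10 `^ delta -> (s + delta) / (1 + s) < sigma ->
  (forall x n, A x n -> [/\ n%:R <= x, (0 < n)%N, (p10_0 n %| n)%N &
    \prod_(i < (trunc_log 10 n).+1) w (digit i n) = (p10_0 n)%:R `^ (- s)]) ->
  exists x0 : R, forall x, x0 <= x -> (ncard (A x))%:R < x `^ sigma.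
Proof.
move=> s0 d0 w0 W; set tau := (s + delta) / (1 + s) => ts AP.
have tau0 : 0 <= tau by rewrite divr_ge0 ?addr_ge0 // ltW.
have r1 : 1 < 10 `^ (sigma - tau) :> R.
  rewrite /powR pnatr_eq0 /= -[ltLHS]expR0 ltr_expR.
  by rewrite mulr_gt0 ?subr_gt0 ?ln_gt0 ?ltr1n.
(* [4 ^ 5] comes from the number of classes; [10^tau] pays for counting up to [10 ^ K.+1] while only
   [10 ^ K <= x] is known. *)
have [K0 K0P] := poly_lt_exp _ (4 ^+ 5 * 10 `^ tau) _ 5 r1.
exists (10 ^+ K0) => x /exists_pow10 [K [K0K Kx xK]].
have AK n : A x n -> (n < 10 ^ K.+1)%N.
  move=> /AP[nx _ _ _]; rewrite -(ltr_nat R) natrX; exact: le_lt_trans xK.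
rewrite (ncard_sum _ _ AK).
apply: le_lt_trans (rankin_count _ _ _ _ _ K s0 d0 w0 W _) _.
  by move=> n; rewrite inE => /AP[].
rewrite -/tau; apply: (@lt_le_trans _ _ ((10 ^+ K) `^ sigma)); last first.
  have x_ge0 : 0 <= x by apply: le_trans Kx; exact: exprn_ge0.
  apply: ge0_ler_powR; rewrite ?nnegrE ?exprn_ge0 //.
  by rewrite ltW // (le_lt_trans tau0).
rewrite -[10 ^+ K]powR_mulrn // powRAC powR_mulrn ?powR_ge0 //.
have -> : 10 `^ sigma = 10 `^ (sigma - tau) * 10 `^ tau :> R.
  by rewrite -powRD ?pnatr_eq0 ?implybT // subrK.
rewrite exprMn [_ ^+ K.+1]exprS mulrA ltr_pM2r ?exprn_gt0 ?powR_gt0 //.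
apply: le_lt_trans (K0P _ K0K).
by rewrite natrM exprMn mulrAC.
Qed.

(** * Numerical weights and the two upper bounds *)

Lemma big_ord_10 (T : Type) (idx : T) (op : T -> T -> T) (F : nat -> T) :
  \big[op/idx]_(d < 10) F d =
    op (F 0%N) (op (F 1%N) (op (F 2%N) (op (F 3%N) (op (F 4%N) (op (F 5%N)
    (op (F 6%N) (op (F 7%N) (op (F 8%N) (op (F 9%N) idx))))))))).
Proof. by rewrite !big_ord_recl big_ord0. Qed.

(** [e] is the weight of a zero digit: 1 where zeros are allowed, 0 where they are forbidden. *)
Definition rankin_weight (R : realType) (e s : R) (d : nat) : R :=
  if d == 0%N then e else d%:R `^ (- s).

Lemma rankin_weight_ge0 (R : realType) (e s : R) d :
  0 <= e -> 0 <= rankin_weight R e s d.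
Proof. by rewrite /rankin_weight; case: ifP => // _ _; exact: powR_ge0. Qed.

Lemma prod_rankin_weight (R : realType) (e s : R) n : (0 < n)%N ->
  (forall i, (i < (trunc_log 10 n).+1)%N -> digit i n = 0%N -> e = 1) ->
  \prod_(i < (trunc_log 10 n).+1) rankin_weight R e s (digit i n) =
  (p10_0 n)%:R `^ (- s).
Proof.
move=> n0 eP; rewrite (p10_0E (trunc_log 10 n).+1 _ n0) ?trunc_log_ltn //.
rewrite natr_prod powR_prod => [|i]; last exact: ler0n.
apply: eq_bigr => i _; rewrite /rankin_weight /nzdigit; case: eqP => // d0.
by rewrite powR1 (eP i).
Qed.

(** Raising to the power [q] reduces a rational bound on an irrational weight to a comparison of
    integers. *)
Lemma powR_frac_le (R : realType) (d a b p q : nat) :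
  (0 < d)%N -> (0 < b)%N -> (0 < q)%N ->
  b%:R ^+ q <= a%:R ^+ q * d%:R ^+ p :> R ->
  d%:R `^ (- (p%:R / q%:R)) <= a%:R / b%:R :> R.
Proof.
move=> d0 b0 q0 le; rewrite -(@ler_pXn2r _ q) ?nnegrE ?powR_ge0 ?divr_ge0 //.
rewrite -powR_mulrn ?powR_ge0 // -powRrM mulNr divfK ?pnatr_eq0 -?lt0n //.
rewrite powR_invn ?ler0n // expr_div_n ler_pdivlMr ?exprn_gt0 ?ltr0n //.
by rewrite mulrC ler_pdivrMr ?exprn_gt0 ?ltr0n.
Qed.

Lemma powR10_frac_ge (R : realType) (a b p q : nat) :
  (0 < b)%N -> (0 < q)%N -> a%:R ^+ q <= 10 ^+ p * b%:R ^+ q :> R ->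
  a%:R / b%:R <= 10 `^ (p%:R / q%:R) :> R.
Proof.
move=> b0 q0 le; rewrite -(@ler_pXn2r _ q) ?nnegrE ?powR_ge0 ?divr_ge0 //.
rewrite -[leRHS]powR_mulrn ?powR_ge0 // -powRrM divfK ?pnatr_eq0 -?lt0n //.
by rewrite powR_mulrn // expr_div_n ler_pdivrMr ?exprn_gt0 ?ltr0n.
Qed.

(** The exponent [76 / 149] lies just below [0.787 * 2.3 - 1.3 = 0.5101], the threshold for
    [(s + delta) / (1 + s) < 0.787]. *)
Lemma sum_rankin_weight_13_10 (R : realType) :
  \sum_(d < 10) rankin_weight R 1 (13 / 10) d <= 10 `^ (76 / 149).
Proof.
rewrite (big_ord_10 _ _ _ (rankin_weight R _ _)) /rankin_weight /= powR1.
apply: (@le_trans _ _ (2589 / 800)); last by apply: powR10_frac_ge => //; lra.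
(* Digits 0 and 1 weigh exactly 1; the fractions bound the weights of 2 to 9 from above. *)
have -> : 2589 / 800 =
    1 + (1 + (1625 / 4000 + (959 / 4000 + (660 / 4000 + (494 / 4000 +
    (390 / 4000 + (319 / 4000 + (268 / 4000 + (230 / 4000 + 0))))))))) :> R
  by lra.
do 2 (apply: lerD => //).
by do 8 (apply: lerD; [by apply: powR_frac_le => //=; lra|]).
Qed.

(** Here digit 0 weighs 0, and [17 / 53] lies just below [0.717 * 2.4 - 1.4 = 0.3208]. *)
Lemma sum_rankin_weight_7_5 (R : realType) :
  \sum_(d < 10) rankin_weight R 0 (7 / 5) d <= 10 `^ (17 / 53).
Proof.
rewrite (big_ord_10 _ _ _ (rankin_weight R _ _)) /rankin_weight /= powR1.
apply: (@le_trans _ _ (523 / 250)); last by apply: powR10_frac_ge => //; lra.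
have -> : 523 / 250 =
    0 + (1 + (758 / 2000 + (430 / 2000 + (288 / 2000 + (211 / 2000 +
    (163 / 2000 + (132 / 2000 + (109 / 2000 + (93 / 2000 + 0))))))))) :> R
  by lra.
do 2 (apply: lerD => //).
by do 8 (apply: lerD; [by apply: powR_frac_le => //=; lra|]).
Qed.

Lemma ncard_N10_0_upper (R : realType) :
  exists x0 : R, forall x, x0 <= x -> (ncard (N10_0 x))%:R < x `^ (787 / 1000).
Proof.
have s0 : 0 < 13 / 10 :> R by lra.
have d0 : 0 <= 76 / 149 :> R by lra.
have lt : (13 / 10 + 76 / 149) / (1 + 13 / 10) < 787 / 1000 :> R.
  by rewrite ltr_pdivrMr; lra.
apply: (ncard_upper _ _ _ _ _ _ s0 d0 _ (sum_rankin_weight_13_10 R) lt).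
  by move=> d; exact: rankin_weight_ge0.
move=> x n [n0 [nx dvd]]; split=> //.
by apply: prod_rankin_weight.
Qed.

Lemma ncard_N10_upper (R : realType) :
  exists x0 : R, forall x, x0 <= x -> (ncard (N10 x))%:R < x `^ (717 / 1000).
Proof.
have s0 : 0 < 7 / 5 :> R by lra.
have d0 : 0 <= 17 / 53 :> R by lra.
have lt : (7 / 5 + 17 / 53) / (1 + 7 / 5) < 717 / 1000 :> R.
  by rewrite ltr_pdivrMr; lra.
apply: (ncard_upper _ _ _ _ _ _ s0 d0 _ (sum_rankin_weight_7_5 R) lt).
  by move=> d; exact: rankin_weight_ge0.
move=> x n [n0 [nx dvd]]; split=> //; first by rewrite -p10_eq_p10_0.
apply: prod_rankin_weight => // i iT d0'.
by have := p10_digit_neq0 n i n0 dvd iT; rewrite d0'.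
Qed.

(** * Second moments and the weak law of large numbers *)

Section Moments.
Variables (R : realType) (p g : nat -> R).
Hypotheses (p_ge0 : forall d, 0 <= p d) (sum_p : \sum_(d < 10) p d = 1).
Hypothesis (mean_g : \sum_(d < 10) p d * g d = 0).

(** [w L] is the law of [L] independent digits drawn from [p], leading zeros included; [G L] is then
    a sum of independent centred variables. *)
Let w L n := \prod_(i < L) p (digit i n).
Let G L n := \sum_(i < L) g (digit i n).

(** Variances of independent variables add: when a digit is appended, the cross term vanishes by
    [mean_g]. *)
Lemma second_moment L : \sum_(0 <= n < 10 ^ L) w L n * G L n ^+ 2 =
  (\sum_(d < 10) p d * g d ^+ 2) * L%:R.
Proof.
elim: L => [|L IH]; first by rewrite big_nat1 /G big_ord0 expr0n !mulr0.
rewrite sum_words -natr1 mulrDr mulr1 -IH.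
transitivity (\sum_(0 <= q < 10 ^ L)
    (w L q * G L q ^+ 2 + w L q * \sum_(d < 10) p d * g d ^+ 2)).
  apply: eq_bigr => q _.
  transitivity (\sum_(d < 10) (w L q * G L q ^+ 2 * p d +
      w L q * (p d * g d ^+ 2) + 2 * w L q * G L q * (p d * g d))).
    apply: eq_bigr => d _.
    rewrite /w /G prod_digits_cons sum_digits_cons -/(w L q) -/(G L q).
    by ring.
  by rewrite !big_split /= -!mulr_sumr sum_p mean_g mulr0 addr0 mulr1.
rewrite big_split -mulr_suml /=; congr (_ + _).
by rewrite sum_prod_digits sum_p expr1n mul1r.
Qed.

(** Chebyshev's inequality: on the event, [G ^ 2] exceeds [(eps * L) ^ 2], while its mean is only
    linear in [L]. *)
Lemma weak_law (eps eta : R) : 0 < eps -> 0 < eta -> exists L0, forall L,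
  (L0 <= L)%N ->
  \sum_(0 <= n < 10 ^ L | eps * L%:R < G L n) w L n <= eta.
Proof.
move=> eps0 eta0; set V := \sum_(d < 10) p d * g d ^+ 2.
have w0 L n : 0 <= w L n by exact: prodr_ge0.
exists (Num.truncn (V / (eps ^+ 2 * eta))).+1 => L LL.
have L0 : 0 < L%:R :> R by rewrite ltr0n (leq_trans _ LL).
have VL : V <= eps ^+ 2 * eta * L%:R.
  rewrite mulrC -ler_pdivrMr ?mulr_gt0 ?exprn_gt0 //.
  by apply: le_trans (ltW (truncnS_gt _)) _; rewrite ler_nat.
rewrite -(@ler_pM2r _ ((eps * L%:R) ^+ 2)) ?exprn_gt0 ?mulr_gt0 //.
apply: (@le_trans _ _ (V * L%:R)); last first.
  have -> : eta * (eps * L%:R) ^+ 2 = eps ^+ 2 * eta * L%:R * L%:R by ring.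
  by rewrite ler_pM2r.
rewrite -second_moment mulr_suml big_mkcond; apply: ler_sum => n _.
case: ifP => epsG; last by rewrite mulr_ge0 ?sqr_ge0.
rewrite ler_wpM2l // lerXn2r ?nnegrE ?ltW // ?mulr_gt0 //.
by rewrite (lt_trans _ epsG) ?mulr_gt0.
Qed.

End Moments.

(** * The digit distribution and its typical words *)

Lemma ln_prod (R : realType) (I : Type) (r : seq I) (F : I -> R) :
  (forall i, 0 < F i) -> ln (\prod_(i <- r) F i) = \sum_(i <- r) ln (F i).
Proof.
move=> F0; elim: r => [|i r IH]; first by rewrite !big_nil ln1.
by rewrite !big_cons lnM ?posrE ?prodr_gt0 // IH.
Qed.

(* A nearly optimal distribution: it almost maximises [entropy / (1 + tau)]
   where [tau] is both the mean of the 2-adic valuation and the frequency of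
   the digit 5, i.e. the relative number of trailing zeros needed. *)
Definition digit_freq (d : nat) : nat :=
  nth 0%N [:: 60; 60; 22; 0; 8; 47; 0; 0; 3; 0]%N d.

Definition digit_prob (R : realType) (d : nat) : R := (digit_freq d)%:R / 200.

Definition word_prob (R : realType) L n : R :=
  \prod_(i < L) digit_prob R (digit i n).

(* [471 / 2000] slightly exceeds the mean [47 / 200] of both valuations, and
   [13 / 20] is slightly less than the entropy to base 10. *)
Definition typical (R : realType) L n : bool :=
  [&& 0 < word_prob R L n, (2000 * digit_val 2 L n <= 471 * L)%N,
      (2000 * digit_val 5 L n <= 471 * L)%N &
      word_prob R L n <= 10 `^ (- (13 / 20 * L%:R))].

Lemma digit_prob_ge0 (R : realType) d : 0 <= digit_prob R d.
Proof. by rewrite divr_ge0. Qed.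

Lemma sum_digit_prob (R : realType) : \sum_(d < 10) digit_prob R d = 1.
Proof.
by rewrite (big_ord_10 _ _ _ (digit_prob R)) /digit_prob /digit_freq /=; lra.
Qed.

Lemma mean_logn_digit (R : realType) p : p \in [:: 2; 5]%N ->
  \sum_(d < 10) digit_prob R d * ((logn p d)%:R - 47 / 200) = 0.
Proof.
(* For 2 the sum is [22 + 2 * 8 + 3 * 3]; for 5 it is the frequency 47 of the digit 5. *)
move=> pP; have meanE : (\sum_(d < 10) digit_freq d * logn p d = 47)%N.
  rewrite (big_ord_10 _ _ _ (fun d => digit_freq d * logn p d)%N).
  by move: pP; rewrite !inE => /orP[] /eqP->.
under eq_bigr do rewrite mulrBr.
rewrite sumrB -mulr_suml sum_digit_prob mul1r -(congr1 (fun k => k%:R) meanE).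
rewrite natr_sum mulr_suml.
apply/eqP; rewrite subr_eq0; apply/eqP; apply: eq_bigr => d _.
by rewrite natrM /digit_prob mulrAC.
Qed.

Lemma ltr_ln_mulX (R : realType) (x y z : R) (m n : nat) :
  0 < x -> 0 < y -> 0 < z -> x * y ^+ m < z ^+ n ->
  ln x + m%:R * ln y < n%:R * ln z.
Proof.
move=> x0 y0 z0; rewrite -ltr_ln ?posrE ?mulr_gt0 ?exprn_gt0 //.
by rewrite lnM ?posrE ?exprn_gt0 // !lnXn // !mulr_natl.
Qed.

(** Multiplied by 200, the claim becomes the integer inequality
    [(\prod F d) * 10 ^ 130 < 200 ^ 200]. Digits of frequency 0 fit in, since [0 ^ 0 = 1]. *)
Lemma entropy_digit_prob (R : realType) :
  \sum_(d < 10) digit_prob R d * ln (digit_prob R d) < - (13 / 20) * ln 10.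
Proof.
pose F d : R := (digit_freq d)%:R ^+ digit_freq d.
have F0 d : 0 < F d.
  rewrite /F; have [->|d0] := posnP (digit_freq d); first by rewrite expr0.
  by rewrite exprn_gt0 // ltr0n.
have probE (d : nat) : digit_prob R d * ln (digit_prob R d) =
    200^-1 * ln (F d) - ln 200 * digit_prob R d.
  rewrite /F /digit_prob; have [->|d0] := posnP (digit_freq d).
    by rewrite expr0 ln1 mul0r !mulr0 mul0r subrr.
  rewrite ln_div ?posrE ?ltr0n // lnXn ?ltr0n // -mulr_natl.
  by move: (ln _) (ln _) => a b; field.
under eq_bigr => d _ do rewrite probE.
rewrite sumrB -!mulr_sumr sum_digit_prob mulr1 -ln_prod //.
have : ln (\prod_(d < 10) F d) + 130%:R * ln 10 < 200%:R * ln 200.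
  apply: ltr_ln_mulX; rewrite ?prodr_gt0 //.
  by rewrite (big_ord_10 _ _ _ F) /F /digit_freq /=; lra.
move: (ln _) (ln _) (ln _) => a b c; lra.
Qed.

Lemma union_bound (R : realType) (F : nat -> R) (A B C D : pred nat) N :
  (forall n, 0 <= F n) ->
  (forall n, 0 < F n -> [|| A n, B n, C n | D n]) ->
  \sum_(0 <= n < N) F n <=
  \sum_(0 <= n < N | A n) F n + (\sum_(0 <= n < N | B n) F n +
    (\sum_(0 <= n < N | C n) F n + \sum_(0 <= n < N | D n) F n)).
Proof.
move=> F0 cover; rewrite [X in X + _]big_mkcond.
rewrite [X in _ + (X + _)]big_mkcond [X in _ + (_ + (X + _))]big_mkcond.
rewrite [X in _ + (_ + (_ + X))]big_mkcond -!big_split /=.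
apply: ler_sum => n _; move: (F0 n); rewrite le_eqVlt => /predU1P[<-|].
  by rewrite !if_same !addr0.
move=> /[dup] Fn /cover.
by move: (A n) (B n) (C n) (D n) => [] [] [] [] //= _; lra.
Qed.

Lemma sumrB_const (R : realType) (f : nat -> R) (c : R) L n :
  \sum_(i < L) (f (digit i n) - c) = \sum_(i < L) f (digit i n) - c * L%:R.
Proof. by rewrite sumrB sumr_const card_ord mulr_natr. Qed.

(** A word of positive mass that is not typical violates one of three deviation bounds, each of
    probability at most [1 / 6] by the weak law. *)
Lemma mass_typical (R : realType) : exists L0, forall L, (L0 <= L)%N ->
  2^-1 <= \sum_(0 <= n < 10 ^ L | typical R L n) word_prob R L n.
Proof.
pose g2 d : R := (logn 2 d)%:R - 47 / 200.
pose g5 d : R := (logn 5 d)%:R - 47 / 200.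
pose mu : R := \sum_(d < 10) digit_prob R d * ln (digit_prob R d).
pose gH d : R := ln (digit_prob R d) - mu.
have m2 : \sum_(d < 10) digit_prob R d * g2 d = 0 by exact: mean_logn_digit.
have m5 : \sum_(d < 10) digit_prob R d * g5 d = 0 by exact: mean_logn_digit.
have mH : \sum_(d < 10) digit_prob R d * gH d = 0.
  under eq_bigr do rewrite mulrBr.
  by rewrite big_split /= sumrN -mulr_suml sum_digit_prob mul1r subrr.
(* The margin [471 / 2000 - 47 / 200]. *)
have e1 : 0 < 1 / 2000 :> R by lra.
have e6 : 0 < 1 / 6 :> R by lra.
have eH : 0 < - (13 / 20) * ln 10 - mu by rewrite subr_gt0 entropy_digit_prob.
have p0 := @digit_prob_ge0 R; have sp := @sum_digit_prob R.
have [L2 P2] := weak_law _ _ _ p0 sp m2 _ _ e1 e6.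
have [L5 P5] := weak_law _ _ _ p0 sp m5 _ _ e1 e6.
have [LH PH] := weak_law _ _ _ p0 sp mH _ _ eH e6.
exists (maxn L2 (maxn L5 LH)) => L.
rewrite !geq_max => /and3P[/P2 {}P2 /P5 {}P5 /PH {}PH].
have total : 1 <= \sum_(0 <= n < 10 ^ L | typical R L n) word_prob R L n +
   (\sum_(0 <= n < 10 ^ L | 1 / 2000 * L%:R < \sum_(i < L) g2 (digit i n))
       word_prob R L n +
   (\sum_(0 <= n < 10 ^ L | 1 / 2000 * L%:R < \sum_(i < L) g5 (digit i n))
       word_prob R L n +
   \sum_(0 <= n < 10 ^ L | (- (13 / 20) * ln 10 - mu) * L%:R <
       \sum_(i < L) gH (digit i n)) word_prob R L n)).
  rewrite -[leLHS](expr1n _ L) -[X in X ^+ L <= _]sp -sum_prod_digits.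
  apply: union_bound => n; first exact: prodr_ge0.
  rewrite -/(word_prob R L n) => wpos.
  case: ltP => h2; first by rewrite orbT.
  case: ltP => h5; first by rewrite !orbT.
  case: ltP => hH; first by rewrite !orbT.
  rewrite !orbF; apply/and4P; split => //.
  - move: h2; rewrite /g2 (sumrB_const R (fun d => (logn 2 d)%:R)).
    rewrite -natr_sum => h2.
    by rewrite -(ler_nat R) !natrM; move: h2; clear; rewrite /digit_val; lra.
  - move: h5; rewrite /g5 (sumrB_const R (fun d => (logn 5 d)%:R)).
    rewrite -natr_sum => h5.
    by rewrite -(ler_nat R) !natrM; move: h5; clear; rewrite /digit_val; lra.
  - rewrite -ler_ln ?posrE ?powR_gt0 // ln_powR /word_prob ln_prod.
      move: hH; rewrite (sumrB_const R (fun d => ln (digit_prob R d))).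
      (* The term [mu * L] cancels, which leaves the bound [- (13 / 20) * ln 10 * L] on the
         logarithm of the mass. *)
      by move: (ln 10); clear => l; lra.
    move=> i; rewrite lt0r digit_prob_ge0 andbT; apply: contraL wpos => /eqP pi.
    by rewrite /word_prob (bigD1 i) //= pi mul0r ltxx.
move: total P2 P5 PH; rewrite /word_prob; lra.
Qed.

(** Typical words carry total mass at least [1 / 2], and each has mass at most
    [10^(- 13 L / 20)]. *)
Lemma count_typical (R : realType) : exists L0, forall L, (L0 <= L)%N ->
  10 `^ (13 / 20 * L%:R) / 2 <=
  (\sum_(0 <= n < 10 ^ L | typical R L n) 1)%N%:R :> R.
Proof.
have [L0 P] := mass_typical R; exists L0 => L /P {}P.
rewrite [leLHS]mulrC -ler_pdivlMr ?powR_gt0 // -powRN.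
apply: le_trans P _; rewrite natr_sum mulr_suml; apply: ler_sum => n.
by rewrite mul1r => /and4P[].
Qed.

(** Positive mass excludes the digits 3, 6, 7 and 9, so only 2 and 5 divide the product, each with
    exponent at most [t]. *)
Lemma p10_0_typical (R : realType) L m t : (0 < m)%N -> (m < 10 ^ L)%N ->
  typical R L m -> (471 * L < 2000 * t.+1)%N -> (p10_0 m %| 10 ^ t)%N.
Proof.
move=> m0 mL /and4P[wpos v2 v5 _] tL.
have val0 p : p \in [:: 3; 7]%N -> digit_val p L m = 0%N.
  move=> pP; apply/eqP; rewrite sum_nat_eq0; apply/forallP => i /=.
  move: wpos; rewrite /word_prob (bigD1 i) //= => wpos.
  have : digit_prob R (digit i m) != 0.
    by apply: contraTneq wpos => ->; rewrite mul0r ltxx.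
  rewrite mulf_eq0 negb_or pnatr_eq0 => /andP[+ _].
  have := digit_lt10 i m; move: (digit i m) => d.
  by move: pP; rewrite !inE => /orP[] /eqP->; do 10 (case: d => [|d] //).
rewrite (p10_0_factors _ _ m0 mL) (val0 3%N) // (val0 7%N) // !muln1.
have -> : (10 ^ t = 2 ^ t * 5 ^ t)%N by rewrite -expnMn.
by apply: dvdn_mul; apply: dvdn_exp2l; lia.
Qed.

(** * The lower bound *)

Lemma ncard_ge (A : set nat) (s : seq nat) (f : nat -> nat) : finite_set A ->
  injective f -> uniq s -> (forall m, m \in s -> A (f m)) ->
  (size s <= ncard A)%N.
Proof.
move=> finA injf us sA; rewrite -(size_map f).
apply: uniq_leq_size; first by rewrite map_inj_uniq.
move=> _ /mapP[m ms ->]; have := in_fset_set finA; move=> /(_ (f m)) ->.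
by rewrite inE; exact: sA.
Qed.

Lemma powR_le_pow10 (R : realType) (x a : R) K :
  0 <= a -> 0 <= x -> x <= 10 ^+ K -> x `^ a <= 10 `^ (a * K%:R).
Proof.
move=> a0 x0 xK; rewrite [a * _]mulrC [leRHS]powRrM [10 `^ _]powR_mulrn //.
by apply: ge0_ler_powR; rewrite ?nnegrE ?exprn_ge0.
Qed.

Lemma ncard_N10_0_lower (R : realType) :
  exists x0 : R, forall x, x0 <= x -> x `^ (526 / 1000) < (ncard (N10_0 x))%:R.
Proof.
have a0 : 0 <= 526 / 1000 :> R by lra.
have [L0 LP] := count_typical R.
(* [2 * L0] ensures [L0 <= L]. The constant makes [KL] hold: [650 * 2000 / 2471] exceeds 526 by only
   about 0.1. *)
exists (10 ^+ (2 * L0 + 100 * 300)) => x /exists_pow10[K [K0K Kx xK]].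
(* A word of length [L] followed by [t] zeros has length at most
   [L * (1 + 471 / 2000) <= K]. *)
pose L := (2000 * K %/ 2471)%N; pose t := (471 * L %/ 2000)%N.
have LtK : (L + t <= K)%N by rewrite /t /L; lia.
have L0L : (L0 <= L)%N by rewrite /L; lia.
have tL : (471 * L < 2000 * t.+1)%N by rewrite /t; lia.
(* Divided by 1000, this leaves a spare factor 10 between the powers of ten, which absorbs the mass
   [1 / 2] and the excluded word 0. *)
have KL : (1000 + 526 * K.+1 <= 650 * L)%N by rewrite /L; lia.
pose s := [seq m <- iota 1 (10 ^ L).-1 | typical R L m].
have sN : (size s <= ncard (N10_0 x))%N.
  apply: (@ncard_ge _ _ (fun m => (m * 10 ^ t)%N) (finite_N10_0 x)).
  - by move=> m n /eqP; rewrite eqn_pmul2r ?expn_gt0 // => /eqP.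
  - by rewrite filter_uniq // iota_uniq.
  move=> m; rewrite mem_filter mem_iota => /and3P[mt m0 mL].
  have {}mL : (m < 10 ^ L)%N by have := expn_gt0 10 L; lia.
  split; first by rewrite muln_gt0 m0 expn_gt0.
  split; last by rewrite p10_0_shift // dvdn_mull // (p10_0_typical R L).
  apply: le_trans Kx; rewrite -natrX ler_nat.
  rewrite (leq_trans _ (_ : 10 ^ (L + t) <= _)%N) ?leq_exp2l //.
  by rewrite expnD leq_mul2r ltnW ?orbT.
have sL : 10 `^ (13 / 20 * L%:R) / 2 <= 1 + (size s)%:R :> R.
  apply: le_trans (LP L L0L) _; rewrite nat1r ler_nat.
  rewrite sum1_count /index_iota subn0 -(prednK (n := 10 ^ L)) ?expn_gt0 //=.
  by rewrite -[leqRHS]add1n size_filter leq_add2r leq_b1.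
have x0 : 0 <= x by apply: le_trans Kx; exact: exprn_ge0.
apply: (@lt_le_trans _ _ (size s)%:R); last by rewrite ler_nat.
have xle : x `^ (526 / 1000) <= 10 `^ (526 / 1000 * K.+1%:R).
  exact: (powR_le_pow10 _ _ _ _ a0 x0 (ltW xK)).
have ylt : 10 * 10 `^ (526 / 1000 * K.+1%:R) <= 10 `^ (13 / 20 * L%:R) :> R.
  rewrite -[X in X * _]powRr1 // -powRD ?pnatr_eq0 ?implybT //.
  apply: ler_powR; first by rewrite ler1n.
  by move: KL; rewrite -(ler_nat R) natrD !natrM; clear; lra.
have y1 : 1 <= 10 `^ (526 / 1000 * K.+1%:R) :> R.
  rewrite -[leLHS](powRr0 10); apply: ler_powR; first by rewrite ler1n.
  exact: mulr_ge0 a0 (ler0n _ _).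
move: sL xle ylt y1; clear.
move: (10 `^ (13 / 20 * _)) (10 `^ (526 / 1000 * _)) (x `^ _) => X Y x'.
lra.
Qed.

Theorem theorem1p2 (R : realType) :
  exists x0 : R, forall x : R, x0 <= x ->
    (ncard (N10 x))%:R < x `^ (717 / 1000) /\
    x `^ (526 / 1000) < (ncard (N10_0 x))%:R /\
    (ncard (N10_0 x))%:R < x `^ (787 / 1000).
Proof.
have [x1 P1] := ncard_N10_upper R.
have [x2 P2] := ncard_N10_0_lower R.
have [x3 P3] := ncard_N10_0_upper R.
exists (Num.max x1 (Num.max x2 x3)) => x; rewrite !ge_max => /and3P[h1 h2 h3].
by split; [exact: P1 | split; [exact: P2 | exact: P3]].
Qed.
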